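(* Let $d,n$ be positive integers with $1\le d\le n$. Then the following hold: (1) For every strictly monotone Ferrers diagram $\mathcal{D}$ of order $n$ and every finite field $\mathbb{F}$, there exists a $[\mathcal{D},\nu_{\min}(\mathcal{D},d),d]_{\mathbb{F}}$ code. (2) For every initially convex Ferrers diagram $\mathcal{D}$ of order $n$ and every finite field $\mathbb{F}$, there exists a $[\mathcal{D},\nu_{\min}(\mathcal{D},d),d]_{\mathbb{F}}$ code.
   Context: Write $[n]=\{1,\ldots,n\}$. A (top-right justified) Ferrers diagram of order $n$ is a subset $\mathcal{D}\subseteq[n]^2$ such that: if $(i,j)\in\mathcal{D}$ and $j\le j'\le n$, then $(i,j')\in\mathcal{D}$; and if $(i,j)\in\mathcal{D}$ and $1\le i'\le i$, then $(i',j)\in\mathcal{D}$. It is identified with the vector $(c_1,\ldots,c_n)$, $c_j=|\{i\in[n]:(i,j)\in\mathcal{D}\}|$, so $0\le c_1\le\cdots\le c_n\le n$ and $\mathcal{D}=\{(i,j)\in[n]^2: i\le c_j\}$. For a field $\mathbb{F}$, $\mathbb{F}^{\mathcal{D}}$ is the space of matrices $(a_{i,j})\in\mathbb{F}^{n\times n}$ with $a_{i,j}=0$ for all $(i,j)\notin\mathcal{D}$. A $[\mathcal{D},k,d]_{\mathbb{F}}$ (Ferrers diagram rank-metric) code is a $k$-dimensional $\mathbb{F}$-subspace $\mathcal{C}\subseteq\mathbb{F}^{\mathcal{D}}$ whose minimum rank distance $\min\{\operatorname{rk}(A):A\in\mathcal{C},A\ne0\}$ equals $d$. (Convention: for $k=0$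 the zero subspace counts as a $[\mathcal{D},0,d]_{\mathbb{F}}$ code.) Define $$\nu_{\min}(\mathcal{D},d)=\min_{0\le j\le d-1}\ \sum_{i=1}^{n-j}\max\{0,c_i-d+1+j\}.$$ The diagram $\mathcal{D}=(c_1,\ldots,c_n)$ is strictly monotone if for every $i\in\{1,\ldots,n-1\}$ with $c_i>0$ one has $c_{i+1}>c_i$. It is initially convex if $c_1\le1$ and $c_{i+1}-c_i\le1$ for every $i\in\{1,\ldots,n-1\}$. *)

(* Defs.v *)
From HB Require Import structures.
From mathcomp Require Import all_boot all_order all_algebra.

Set Implicit Arguments.
Unset Strict Implicit.
Unset Printing Implicit Defensive.

(* Rows and columns are indexed by 'I_n = {0, ..., n-1} instead of
   {1, ..., n}. *)

Definition ferrers n (D : {set 'I_n * 'I_n}) : Prop :=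
  (forall i j j' : 'I_n, (i, j) \in D -> j <= j' -> (i, j') \in D) /\
  (forall i i' j : 'I_n, (i, j) \in D -> i' <= i -> (i', j) \in D).

Definition col_count n (D : {set 'I_n * 'I_n}) (j : 'I_n) : nat :=
  #|[set i : 'I_n | (i, j) \in D]|.

Definition strictly_monotone n (D : {set 'I_n * 'I_n}) : Prop :=
  forall i i' : 'I_n, i' = i.+1 :> nat ->
    0 < col_count D i -> col_count D i < col_count D i'.

Definition initially_convex n (D : {set 'I_n * 'I_n}) : Prop :=
  (forall i : 'I_n, i = 0 :> nat -> col_count D i <= 1) /\
  (forall i i' : 'I_n, i' = i.+1 :> nat ->
    col_count D i' <= col_count D i + 1).

(* Subtraction on nat is truncated, so (c + 1 + j) - d is
   max(0, c - d + 1 + j); the 0-based condition i < n - j selects the first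
   n - j columns. *)
Definition nu n (D : {set 'I_n * 'I_n}) (d j : nat) : nat :=
  \sum_(i < n | i < n - j) (col_count D i + 1 + j - d).

(* For 0 < d the default value nu D d 0 is itself the term j = 0 of the
   range, so this is the minimum over 0 <= j <= d - 1. *)
Definition nu_min n (D : {set 'I_n * 'I_n}) (d : nat) : nat :=
  \big[minn/nu D d 0]_(j < d) nu D d j.

Definition supported_on n (D : {set 'I_n * 'I_n}) (F : fieldType)
    (A : 'M[F]_n) : Prop :=
  forall i j : 'I_n, (i, j) \notin D -> A i j = 0%R.

Definition min_rank_distance n (F : fieldType) (C : {vspace 'M[F]_n})
    (d : nat) : Prop :=
  (exists2 A : 'M[F]_n, A \in C /\ A <> 0%R & \rank A = d) /\
  (forall A : 'M[F]_n, A \in C -> A <> 0%R -> d <= \rank A).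

(* The zero space has no nonzero matrix, and counts as a code of dimension 0
   for every d. *)
Definition ferrers_code n (D : {set 'I_n * 'I_n}) (k d : nat) (F : fieldType)
    (C : {vspace 'M[F]_n}) : Prop :=
  [/\ forall A : 'M[F]_n, A \in C -> supported_on D A,
      \dim C = k
    & k = 0 \/ min_rank_distance C d].

(* Main.v *)
(* Let q = #|F| and let tau y = y^q - y on an extension L of F. Choose x in L
   with tau^(n-1) x = 1 and put e_i = tau^(n-1-i) x; then e_0, ..., e_(n-1) is a
   basis adapted to the flag of the kernels of the tau^i, and since
   tau (y z) = tau y tau z + tau y z + y tau z the product e_s e_t lies in the
   span of e_0, ..., e_(s+t). For a strictly monotone D, each cell (s, k) of D
   gives the map y |-> e_s tau^k y, whose matrix in this basis is supported on
   D. A nonzero combination of such maps with k <= n - d is evaluated by a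
   q-polynomial of q-degree at most n - d, so its kernel has dimension at most
   n - d and its rank is at least d. There are as many of these cells as the
   term j = d - 1 of nu, which is the minimum because one can shift the cells
   of D along the diagonal. Reflection in the antidiagonal turns initially
   convex diagrams into strictly monotone ones. *)

Require Import Defs.
From HB Require Import structures.
From mathcomp Require Import all_boot all_order all_algebra all_fingroup.
From mathcomp Require Import all_solvable all_field ring zify.

Set Implicit Arguments.
Unset Strict Implicit.
Unset Printing Implicit Defensive.

Import GRing.Theory.

(** * Polynomials representing the iterates of [tau] *)

Section FrobeniusPolynomial.

Local Open Scope ring_scope.

Variables (q : nat) (q_gt1 : (1 < q)%N).

(** The ring is left arbitrary: over [F] these polynomials yield a splitting field, over [L] they
    bound numbers of roots. *)
Definition frob_poly (R : nzRingType) (k : nat) : {poly R} :=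
  iter k (fun p => p ^+ q - p) 'X.

Lemma size_frob_poly (R : idomainType) (k : nat) :
  size (frob_poly R k) = (q ^ k).+1.
Proof.
elim: k => [|k IHk]; first by rewrite size_polyX.
rewrite /frob_poly /= -/(frob_poly R k); set p := frob_poly R k in IHk *.
have p_neq0: p != 0 by rewrite -size_poly_gt0 IHk.
have sz_pq: size (p ^+ q) = (q ^ k.+1).+1.
  have := size_exp p q; rewrite IHk /= -expnSr => <-.
  by rewrite prednK // size_poly_gt0 expf_neq0.
by rewrite size_polyDl sz_pq // size_polyN IHk ltnS ltn_exp2l.
Qed.

Lemma map_frob_poly (R S : nzRingType) (f : {rmorphism R -> S}) (k : nat) :
  map_poly f (frob_poly R k) = frob_poly S k.
Proof.
elim: k => [|k IHk]; first exact: map_polyX.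
by rewrite /frob_poly /= rmorphB rmorphXn /= -/(frob_poly R k) IHk.
Qed.

(** The degrees [q ^ k] increase strictly, so the last nonzero coefficient fixes the degree and
    nothing can cancel it. *)
Lemma frob_poly_comb (R : idomainType) (m : nat) (a : nat -> R) :
  let f := \sum_(k < m.+1) a k *: frob_poly R k in
  (size f <= (q ^ m).+1)%N /\
  ((exists2 k : nat, (k <= m)%N & a k != 0) -> f != 0).
Proof.
elim: m => [|m [szf f_neq0]] /=.
  rewrite big_ord1 (leq_trans (size_scale_leq _ _)) ?size_frob_poly //.
  split=> // -[k]; rewrite leqn0 => /eqP-> a0.
  by rewrite -size_poly_gt0 size_scale // size_frob_poly.
rewrite big_ord_recr /=; set f := \sum_(k < _) _ in szf f_neq0 *.
have lt_qm: (q ^ m < q ^ m.+1)%N by rewrite ltn_exp2l.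
have [a0|am] := eqVneq (a m.+1) 0.
  rewrite a0 scale0r addr0 (leq_trans szf) 1?ltnW //; split=> // -[k].
  rewrite leq_eqVlt => /predU1P[->|lt_km ak].
    by rewrite a0 eqxx.
  by apply: f_neq0; exists k.
have sz_m: size (a m.+1 *: frob_poly R m.+1) = (q ^ m.+1).+1.
  by rewrite size_scale // size_frob_poly.
have sz: size (f + a m.+1 *: frob_poly R m.+1) = (q ^ m.+1).+1.
  by rewrite addrC size_polyDl sz_m // (leq_ltn_trans szf).
by rewrite sz; split=> // _; rewrite -size_poly_gt0 sz.
Qed.

End FrobeniusPolynomial.

(** * The operator [tau]: linearity, kernel and root counts *)

Section FrobeniusMinusOne.

Local Open Scope ring_scope.

Variables (F : finFieldType) (L : fieldExtType F).

Definition tau (y : L) : L := y ^+ #|F| - y.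

(** This is what makes the [#|F|]-th power additive on [L]. *)
Lemma card_pchar_nat : [pchar L].-nat #|F|.
Proof.
have [p pr_p abF] := is_abelemP (finField_is_abelem F).
have := abelem_pgroup abF; rewrite /pgroup cardsT => pF.
have pcF : p \in [pchar F].
  by case/(p_natP): (pF) => m oF; apply: card_finPcharP oF pr_p.
by apply: sub_in_pnat pF => r _; rewrite inE => /eqP ->; rewrite (pchar_lalg L).
Qed.

Lemma tau_is_linear : linear tau.
Proof.
move=> a y z; rewrite /tau exprDn_pchar ?card_pchar_nat // exprZn expf_card.
by rewrite opprD addrACA -scalerBr.
Qed.

HB.instance Definition _ :=
  GRing.isLinear.Build F L L _ tau tau_is_linear.

Lemma tau_1 : tau (1 : L) = 0.
Proof. by rewrite /tau expr1n subrr. Qed.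

Lemma iter_tau0 (k : nat) : iter k tau (0 : L) = 0.
Proof. by elim: k => //= k ->; rewrite linear0. Qed.

Lemma iter_tau_linear (k : nat) : linear (iter k tau).
Proof. by elim: k => [|k IHk] a u v //=; rewrite IHk linearP. Qed.

Lemma iter_tau_comb (k n : nat) (g : nat -> F) (z : nat -> L) :
  iter k tau (\sum_(i < n) g i *: z i) = \sum_(i < n) g i *: iter k tau (z i).
Proof.
elim: n => [|n IHn]; first by rewrite !big_ord0 iter_tau0.
by rewrite !big_ord_recr /= addrC iter_tau_linear IHn addrC.
Qed.

Lemma tauM (y z : L) : tau (y * z) = tau y * tau z + tau y * z + y * tau z.
Proof.
by rewrite /tau exprMn; ring.
Qed.

(** Over [F] the polynomial ['X^#|F| - 'X] is the product of all ['X - a], so it has no further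
    roots in [L]. *)
Lemma tau0_scalar (y : L) : tau y = 0 -> exists a : F, y = a%:A.
Proof.
move=> ty0.
have : (map_poly (in_alg L) ('X^#|F| - 'X)).[y] = 0.
  by rewrite rmorphB /= map_polyXn map_polyX !hornerE.
rewrite finField_genPoly rmorph_prod horner_prod => /eqP/prodf_eq0[a _].
rewrite rmorphB /= map_polyX map_polyC !hornerE subr_eq0 => /eqP->.
by exists a.
Qed.

Lemma horner_frob_poly (k : nat) (y : L) :
  (frob_poly #|F| L k).[y] = iter k tau y.
Proof.
elim: k => [|k IHk]; first by rewrite hornerX.
by rewrite /frob_poly /= -/(frob_poly _ L k) !hornerE IHk.
Qed.

Lemma size_tau_roots (m : nat) (a : nat -> L) (rs : seq L) :
    (exists2 k : nat, (k <= m)%N & a k != 0) -> uniq rs ->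
    (forall y, y \in rs -> \sum_(k < m.+1) a k * iter k tau y = 0) ->
  (size rs <= #|F| ^ m)%N.
Proof.
move=> a_neq0 uniq_rs rs0.
have [szf /(_ a_neq0) f_neq0] := frob_poly_comb (finNzRing_gt1 F) m a.
rewrite -ltnS; apply: leq_trans szf; apply: max_poly_roots => //.
apply/allP=> y /rs0 y0; rewrite rootE horner_sum; apply/eqP.
by rewrite -[RHS]y0; apply: eq_bigr => k _; rewrite hornerZ horner_frob_poly.
Qed.

End FrobeniusMinusOne.

Arguments tau {F L} y.

(** * Existence of the starting element of the chain *)

Section TauChain.

Local Open Scope ring_scope.

Lemma iter_tau_onto_1 (F : finFieldType) (m : nat) :
  exists (L : fieldExtType F) (x : L), iter m tau x = 1.
Proof.
have q_gt1 := finNzRing_gt1 F.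
pose p : {poly F} := frob_poly #|F| F m - 1.
have sz_p: size p = (#|F| ^ m).+1.
  rewrite size_polyDl size_frob_poly // size_polyN size_poly1.
  by rewrite ltnS expn_gt0 ltnW.
have p_neq0: p != 0 by rewrite -size_poly_gt0 sz_p.
have [L [rs Drs _]] := FinSplittingFieldFor p_neq0.
exists L.
(* With no roots [p] would be a constant up to association, against its degree [#|F| ^ m > 0]. *)
case: rs Drs => [|x rs] Drs.
  move/eqp_size: Drs; rewrite big_nil size_map_poly sz_p size_poly1.
  by move/eqP; rewrite eqSS expn_eq0 gtn_eqF // ltnW.
exists x.
have : root (map_poly (in_alg L) p) x.
  by rewrite (eqp_root Drs) big_cons rootM root_XsubC eqxx.
rewrite /p rmorphB rmorph1 /= (map_frob_poly _ (in_alg L)) /root.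
rewrite hornerD hornerN hornerC.
by rewrite horner_frob_poly subr_eq0 => /eqP.
Qed.

End TauChain.


(** * The chain, its flag, and matrices of operators in the chain basis *)

Section TauFlag.

Local Open Scope ring_scope.

Variables (F : finFieldType) (L : fieldExtType F) (m : nat) (x : L).
Hypothesis iter_x : iter m tau x = 1.

(** Here [m] stands for n - 1. Past [m] the truncated subtraction keeps returning [x], so the chain
    property stops there. *)
Definition tau_chain (i : nat) : L := iter (m - i) tau x.

Local Notation e := tau_chain.

Lemma tau_chain0 : e 0 = 1.
Proof. by rewrite /e /tau_chain subn0. Qed.

Lemma iter_tau_chain (k j : nat) : (j <= m)%N ->
  iter k tau (e j) = if (k <= j)%N then e (j - k) else 0.
Proof.
move=> le_jm; rewrite /e /tau_chain -iterD; case: leqP => [le_kj|lt_jk].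
  by congr (iter _ _ _); lia.
(* The first [m] iterations reach 1, and at least one more remains to kill it. *)
have -> : (k + (m - j) = (k - j).-1.+1 + m)%N by lia.
by rewrite iterD iterSr iter_x tau_1 iter_tau0.
Qed.

Lemma tau_chainS (i : nat) : (i < m)%N -> tau (e i.+1) = e i.
Proof. by move=> lt_im; have := iter_tau_chain 1 lt_im; rewrite /= subn1. Qed.

Definition tau_flag (r : nat) : {vspace L} := (\sum_(i < r) <[e i]>)%VS.

Lemma tau_flagS (r : nat) : tau_flag r.+1 = (tau_flag r + <[e r]>)%VS.
Proof. exact: big_ord_recr. Qed.

Lemma mem_tau_flag (i r : nat) : (i < r)%N -> e i \in tau_flag r.
Proof.
by move=> lt_ir; rewrite memvE (sumv_sup (Ordinal lt_ir)).
Qed.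

Lemma tau_flag_sub (r r' : nat) :
  (r <= r')%N -> (tau_flag r <= tau_flag r')%VS.
Proof.
move=> le_rr'; apply/subv_sumP => i _; rewrite -memvE.
by rewrite mem_tau_flag // (leq_trans (ltn_ord i)).
Qed.

Lemma tau_flag_preim (r : nat) (z : L) : (r <= m)%N -> z \in tau_flag r ->
  exists2 w, w \in tau_flag r.+1 & tau w = z.
Proof.
elim: r z => [|r IHr] z le_rm.
  rewrite /tau_flag big_ord0 memv0 => /eqP->.
  by exists 0; rewrite ?mem0v ?linear0.
rewrite tau_flagS => /memv_addP[z1 z1r [_ /vlineP[a ->] ->]].
have [w1 w1r <-] := IHr z1 (ltnW le_rm) z1r.
exists (w1 + a *: e r.+1); last by rewrite linearD linearZ /= tau_chainS.
rewrite tau_flagS memv_add //; apply/memvZ/memv_line.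
Qed.

(** Two preimages under [tau] differ by a scalar, that is, by a multiple of [e 0], which already
    lies in the flag. *)
Lemma tau_flag_lift (r : nat) (y : L) :
  (r <= m)%N -> tau y \in tau_flag r -> y \in tau_flag r.+1.
Proof.
move=> le_rm /(tau_flag_preim le_rm)[w wr tw].
have [|a Dyw] := @tau0_scalar F L (y - w).
  by rewrite linearB /= tw subrr.
rewrite -(subrK w y) Dyw memvD // -tau_chain0 memvZ //.
exact: mem_tau_flag.
Qed.

Lemma tau_chainM (s t : nat) :
  (s + t <= m)%N -> e s * e t \in tau_flag (s + t).+1.
Proof.
have [k] := ubnP (s + t); elim: k s t => // k IHk [|s] [|t] le_k le_m.
- by rewrite tau_chain0 mul1r -tau_chain0 mem_tau_flag.
- by rewrite tau_chain0 mul1r mem_tau_flag.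
- by rewrite tau_chain0 mulr1 mem_tau_flag // addn0.
(* Each of the three products in [tauM] has a smaller index sum, so the induction applies to all of
   them. *)
apply: tau_flag_lift => //; rewrite tauM !tau_chainS; try lia.
rewrite !memvD //.
- apply: subvP (IHk s t _ _); try lia; apply: tau_flag_sub; lia.
- apply: subvP (IHk s t.+1 _ _); try lia; apply: tau_flag_sub; lia.
- apply: subvP (IHk s.+1 t _ _); try lia; apply: tau_flag_sub; lia.
Qed.

(** Applying [tau] as often as the top index kills all lower terms and sends the top one to 1, which
    isolates its coefficient. *)
Lemma tau_chain_indep (r : nat) (g : nat -> F) : (r <= m.+1)%N ->
  \sum_(i < r) g i *: e i = 0 -> forall i : nat, (i < r)%N -> g i = 0.
Proof.
elim: r => // r IHr lt_rm sum0; have gr0 : g r = 0.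
  have := congr1 (iter r tau) sum0.
  rewrite iter_tau0 iter_tau_comb big_ord_recr /=.
  rewrite big1 => [|i _].
    rewrite add0r iter_tau_chain // leqnn subnn tau_chain0.
    by move/eqP; rewrite scaler_eq0 oner_eq0 orbF => /eqP.
  rewrite iter_tau_chain; last by have := ltn_ord i; lia.
  by rewrite leqNgt ltn_ord scaler0.
move: sum0; rewrite big_ord_recr /= gr0 scale0r addr0 => /IHr g0 i.
by rewrite ltnS leq_eqVlt => /predU1P[->|/g0->] //; apply: ltnW.
Qed.

Definition tau_basis : m.+1.-tuple L := [tuple e i | i < m.+1].

Local Notation B := tau_basis.

Lemma nth_tau_basis (i : 'I_m.+1) : B`_i = e i.
Proof. by rewrite -tnth_nth tnth_mktuple. Qed.

Lemma tau_basis_free : free B.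
Proof.
apply/freeP=> k sum0 i.
have := @tau_chain_indep m.+1 (fun j => k (inord j)) (leqnn _).
rewrite (eq_bigr (fun j : 'I_m.+1 => k j *: B`_j)) => [|j _].
  by move=> /(_ sum0 i (ltn_ord i)); rewrite inord_val.
by rewrite inord_val nth_tau_basis.
Qed.

Lemma tau_flag_span (r : nat) :
  (r <= m.+1)%N -> (tau_flag r <= <<B>>)%VS.
Proof.
move=> le_rm; apply/subv_sumP => i _; rewrite -memvE.
have lt_im := leq_trans (ltn_ord i) le_rm.
rewrite -(nth_tau_basis (Ordinal lt_im)) memv_span //.
by rewrite mem_nth // size_tuple.
Qed.

Lemma coord_tau_flag (r : nat) (i : 'I_m.+1) (y : L) :
  y \in tau_flag r -> (r <= i)%N -> coord B i y = 0.
Proof.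
move=> yr le_ri; have {yr} /memv_sumP[z zP ->] := yr.
rewrite linear_sum big1 // => j _; have /vlineP[a ->] := zP j isT.
have lt_jm : (j < m.+1)%N.
  by apply: leq_trans (ltn_ord i); rewrite ltnW // ltnS (leq_trans _ le_ri).
rewrite linearZ /= -(nth_tau_basis (Ordinal lt_jm)).
rewrite coord_free ?tau_basis_free //.
by rewrite -val_eqE /= ltn_eqF ?mulr0 // (leq_trans (ltn_ord j)).
Qed.

(** [L] may exceed the span of [B], so this represents [f] on the chain only when the images of the
    chain stay in that span. *)
Definition chain_mx (f : L -> L) : 'M[F]_m.+1 :=
  \matrix_(i, j) coord B i (f (e j)).

(** Vectors killed by the matrix give distinct roots of a nonzero polynomial of degree at most
    [#|F| ^ r]; comparing powers of [#|F|] bounds the nullity by [r]. *)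
Lemma chain_mx_rank (r : nat) (a : nat -> L) :
    let f y := \sum_(k < r.+1) a k * iter k tau y in
    (exists2 k : nat, (k <= r)%N & a k != 0) ->
    (forall j : 'I_m.+1, f (e j) \in <<B>>%VS) ->
  (m.+1 - r <= \rank (chain_mx f))%N.
Proof.
move=> f a_neq0 fB; set A := chain_mx f; set K := kermx A^T.
have f_lin : linear f.
  move=> c u v; rewrite /f scaler_sumr -big_split; apply: eq_bigr => k _ /=.
  by rewrite iter_tau_linear mulrDr scalerAr.
(* [y] parametrizes the roots without repetition by a full space of row vectors, which makes them
   easy to count. *)
pose y (v : 'rV[F]_(\rank K)) := \sum_j (v *m row_base K) 0 j *: e j.
have y_inj : injective y.
  move=> v w eq_y; apply: (row_free_inj (row_base_free K)).
  apply/rowP=> j; apply/eqP; rewrite -subr_eq0; apply/eqP.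
  move/freeP: tau_basis_free.
  move=> /(_ (fun j => (v *m row_base K) 0 j - (w *m row_base K) 0 j)); apply.
  move/eqP: eq_y; rewrite -subr_eq0 -sumrB => /eqP eq_y.
  by rewrite -[RHS]eq_y; apply: eq_bigr => i _; rewrite nth_tau_basis scalerBl.
have f_y v : f (y v) = 0.
  pose fl : {linear L -> L} := HB.pack f (GRing.isLinear.Build F L L _ _ f_lin).
  rewrite -[f]/(fl : _ -> _) linear_sum /=.
  set u := v *m row_base K.
  have u0 : u *m A^T = 0.
    have /submxP[w ->] : (u <= K)%MS.
      by rewrite (submx_trans (submxMl _ _)) ?eq_row_base.
    by rewrite -mulmxA mulmx_ker mulmx0.
  transitivity (\sum_i (u *m A^T) 0 i *: e i); last first.
    by rewrite u0 big1 // => i _; rewrite mxE scale0r.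
  rewrite (eq_bigr (fun j => \sum_i (u 0 j * A i j) *: e i)) => [|j _].
    rewrite exchange_big; apply: eq_bigr => i _ /=.
    rewrite [in RHS]mxE scaler_suml; apply: eq_bigr => j _.
    by rewrite [A^T j i]mxE.
  rewrite -[f _]/(fl _) linearZ /= (coord_span (fB j)) scaler_sumr.
  by apply: eq_bigr => i _; rewrite nth_tau_basis scalerA [A i j]mxE.
have := @size_tau_roots F L r a [seq y v | v <- enum 'rV[F]_(\rank K)] a_neq0.
have roots_y z : z \in [seq y v | v <- enum 'rV_(\rank K)] -> f z = 0.
  by case/mapP=> v _ ->.
rewrite map_inj_uniq ?enum_uniq // => /(_ isT roots_y).
rewrite size_map -cardE card_mx mul1n leq_exp2l ?finNzRing_gt1 //.
by rewrite mxrank_ker mxrank_tr; lia.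
Qed.

End TauFlag.

(** * Cell counts in Ferrers diagrams and the minimum of [nu] *)

Lemma nu_min_eq n (D : {set 'I_n * 'I_n}) (d j0 : nat) :
  j0 < d -> (forall j, j < d -> nu D d j0 <= nu D d j) ->
  nu_min D d = nu D d j0.
Proof.
move=> lt_j0 min_j0; apply/eqP; rewrite eqn_leq; apply/andP; split.
  rewrite /nu_min; have := mem_index_enum (Ordinal lt_j0).
  elim: (index_enum _) => // j s IHs; rewrite inE big_cons geq_min.
  by case/predU1P=> [<-|/IHs->]; rewrite ?leqnn ?orbT.
rewrite /nu_min; elim/big_ind: _ => [|a b le_a le_b|j _]; last exact: min_j0.
  by rewrite min_j0 // (leq_trans _ lt_j0).
by rewrite leq_min le_a le_b.
Qed.

Section FerrersDiagrams.

Variables (n : nat) (D : {set 'I_n * 'I_n}).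
Hypothesis ferrersD : ferrers D.

Lemma card_ord_ltn (c : nat) : c <= n -> #|[set i : 'I_n | i < c]| = c.
Proof.
move=> le_cn; rewrite cardsE -sum1_card.
by rewrite (big_ord_narrow le_cn) sum1_card card_ord.
Qed.

Lemma col_count_leq (j : 'I_n) : col_count D j <= n.
Proof. by rewrite -[leqRHS]card_ord max_card. Qed.

(** A column containing row [i] contains the first [i + 1] rows; one avoiding row [i] lies within
    the first [i]. *)
Lemma mem_ferrers (i j : 'I_n) : ((i, j) \in D) = (i < col_count D j).
Proof.
have [_ downD] := ferrersD; apply/idP/idP => [ijD|].
  rewrite -[i.+1]card_ord_ltn //; apply/subset_leq_card/subsetP => k.
  by rewrite !inE ltnS; apply: downD.
apply: contraLR => ij_nD; rewrite -leqNgt.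
rewrite -[leqRHS](card_ord_ltn (ltnW (ltn_ord i))).
apply/subset_leq_card/subsetP => k; rewrite !inE ltnNge => kjD.
by apply: contra ij_nD; apply: downD.
Qed.

(* The cells of the diagram left after deleting its last [j] columns and its
   first [d - 1 - j] rows. *)
Definition trimmed (d j : nat) : {set 'I_n * 'I_n} :=
  [set p in D | (p.2 < n - j) && (d.-1 - j <= p.1)].

(** Removing [d - 1 - j] top rows from a column of height [c] leaves [c + 1 + j - d] cells,
    truncated at 0. *)
Lemma nu_card (d j : nat) : j < d -> nu D d j = #|trimmed d j|.
Proof.
move=> lt_jd; pose Q (k i : 'I_n) := (i < col_count D k) && (d.-1 - j <= i).
rewrite /nu (eq_bigr (fun k => \sum_(i | Q k i) 1)) => [|k _].
  rewrite pair_big_dep -sum1_card /=.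
  rewrite (reindex (fun p : 'I_n * 'I_n => (p.2, p.1))) /=; last first.
    by exists (fun p => (p.2, p.1)) => -[].
  by apply: eq_bigl => -[i k]; rewrite !inE mem_ferrers /Q /= andbCA.
rewrite -(big_geq_mkord _ _ (fun i => i < col_count D k) (fun=> 1)).
have le_cn := col_count_leq k.
rewrite (eq_bigl (fun i => true && (i < col_count D k))) //.
by rewrite -big_nat_widen // sum_nat_const_nat muln1; lia.
Qed.

Hypothesis monoD : strictly_monotone D.

Lemma col_count_shift (j j' : 'I_n) :
  j <= j' -> 0 < col_count D j -> col_count D j + (j' - j) <= col_count D j'.
Proof.
move=> le_jj' c_gt0; have [t Dj'] : exists t, j' = j + t :> nat.
  by exists (j' - j); lia.
elim: t j' Dj' {le_jj'} => [|t IHt] j' Dj'.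
  have -> : j' = j by apply/val_inj; rewrite /= Dj' addn0.
  by rewrite subnn addn0.
have lt_n : j + t < n by have := ltn_ord j'; lia.
have /= := IHt (Ordinal lt_n) erefl.
have /= := @monoD (Ordinal lt_n) j'.
by rewrite Dj' addnS => /(_ erefl); lia.
Qed.

(** The shift by one step down and right is injective; strict growth of the columns keeps the
    shifted cells in [D], and it trades one deleted column for one deleted row. *)
Lemma card_trimmedS (d j : nat) :
  j.+1 < d -> #|trimmed d j.+1| <= #|trimmed d j|.
Proof.
(* The default value of [insubd] is never taken on the cells concerned, by [cellP]. *)
move=> lt_jd; pose up (i : 'I_n) := insubd i i.+1.
have upE (i : 'I_n) : i.+1 < n -> up i = i.+1 :> nat.
  by move=> lt_in; rewrite val_insubd lt_in.
pose f (p : 'I_n * 'I_n) := (up p.1, up p.2).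
have cellP p : p \in trimmed d j.+1 ->
    [/\ p.1.+1 < n, p.2.+1 < n & f p \in trimmed d j].
  case: p => i k; rewrite !inE mem_ferrers /= => /and3P[lt_ic lt_kn le_ei].
  have lt_k1n : k.+1 < n by lia.
  have := @col_count_shift k (up k); rewrite upE // subSnn addn1.
  rewrite leqnSn (leq_ltn_trans _ lt_ic) // => /(_ isT isT) lt_cc.
  have lt_i1n : i.+1 < n.
    by apply: leq_trans (col_count_leq (up k)); apply: leq_trans lt_cc.
  rewrite !upE // mem_ferrers upE //; split=> //=.
  by rewrite (leq_ltn_trans lt_ic lt_cc); lia.
have f_inj : {in trimmed d j.+1 &, injective f}.
  move=> p p' /cellP[lt1 lt2 _] /cellP[lt1' lt2' _] [].
  move=> /(congr1 val)/=; rewrite !upE // => -[eq1].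
  move=> /(congr1 val)/=; rewrite !upE // => -[eq2].
  case: p p' eq1 eq2 {lt1 lt2 lt1' lt2'} => ? ? [? ?] /=.
  by move=> /val_inj-> /val_inj->.
rewrite -(card_in_imset f_inj); apply/subset_leq_card/subsetP.
move=> _ /imsetP[p pT ->].
by case/cellP: pT.
Qed.

Lemma nu_strictly_monotone_min (d j : nat) : j < d -> nu D d d.-1 <= nu D d j.
Proof.
have [k] := ubnP (d.-1 - j); elim: k j => // k IHk j le_k lt_jd.
have [->//|neq] := eqVneq j d.-1.
apply: leq_trans (IHk j.+1 _ _) _; [lia | lia |].
by rewrite !nu_card ?card_trimmedS //; lia.
Qed.

Lemma nu_min_strictly_monotone (d : nat) :
  0 < d -> nu_min D d = nu D d d.-1.
Proof.
move=> d_gt0; apply: nu_min_eq => [|j]; first by rewrite prednK.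
exact: nu_strictly_monotone_min.
Qed.

End FerrersDiagrams.

(** * Reflection of diagrams in the antidiagonal *)

Section AntiTranspose.

Variable n : nat.

Definition antitr (D : {set 'I_n * 'I_n}) : {set 'I_n * 'I_n} :=
  [set p | (rev_ord p.2, rev_ord p.1) \in D].

Lemma mem_antitr (D : {set 'I_n * 'I_n}) (i j : 'I_n) :
  ((i, j) \in antitr D) = ((rev_ord j, rev_ord i) \in D).
Proof. by rewrite inE. Qed.

Variable D : {set 'I_n * 'I_n}.
Hypothesis ferrersD : ferrers D.

Lemma ferrers_antitr : ferrers (antitr D).
Proof.
have [rightD upD] := ferrersD.
split=> i j k; rewrite !mem_antitr => ijD le_jk.
  by apply: upD ijD _; rewrite /=; lia.
by apply: rightD ijD _; rewrite /=; lia.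
Qed.

(** Columns of the reflection are rows of [D]. Let [j] be the first column reaching row [rev_ord i].
    By convexity column [j - 1] is at most one cell shorter, so it still reaches the row above,
    which therefore starts strictly earlier. *)
Lemma strictly_monotone_antitr : initially_convex D ->
  strictly_monotone (antitr D).
Proof.
move=> [convex0 convexS] i i' Di' c_gt0.
have memD := mem_ferrers ferrersD; have memD' := mem_ferrers ferrers_antitr.
have n_gt0 : 0 < n by apply: leq_trans (ltn_ord i).
have ri' : rev_ord i = (rev_ord i').+1 :> nat.
  by rewrite /=; have := ltn_ord i'; lia.
have [j Dj] : exists j, rev_ord i < col_count D j.
  exists (rev_ord (Ordinal n_gt0)).
  by rewrite -memD -mem_antitr memD'.
case: (@arg_minnP _ j (fun j => rev_ord i < col_count D j) val Dj).
move=> {Dj}j Dj min_j.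
(* Column 0 has height at most 1, while [rev_ord i] is at least 1 because column [i'] follows column
   [i]. *)
have j_gt0 : 0 < j.
  rewrite lt0n; apply/eqP => /convex0; have := Dj; lia.
have lt_j0 : j.-1 < n by have := ltn_ord j; lia.
pose j0 := Ordinal lt_j0.
have Dj0 : col_count D j0 <= rev_ord i.
  by rewrite leqNgt; apply/negP => /min_j /=; lia.
have le_cj : col_count D j <= col_count D j0 + 1.
  by apply: convexS; rewrite /= prednK.
(* In the reflection, row [rev_ord j0] misses column [i] and meets column [i'], so it separates
   their heights. *)
apply: (@leq_ltn_trans (rev_ord j0)).
  by rewrite leqNgt -memD' mem_antitr rev_ordK memD -leqNgt.
by rewrite -memD' mem_antitr rev_ordK memD -ltnS -ri'; lia.
Qed.

(** The reflection exchanges last columns with first rows, hence the two kinds of trimming. *)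
Lemma nu_antitr (d j : nat) : j < d -> d <= n ->
  nu D d j = nu (antitr D) d (d.-1 - j).
Proof.
move=> lt_jd le_dn.
rewrite (nu_card ferrersD) // (nu_card ferrers_antitr); last lia.
pose f (p : 'I_n * 'I_n) := (rev_ord p.2, rev_ord p.1).
have fK : involutive f by case=> i k; rewrite /f /= !rev_ordK.
rewrite -(card_imset _ (inv_inj fK)); apply: eq_card => -[i k].
rewrite -[(i, k)]fK mem_imset; last exact: inv_inj.
rewrite !inE /= !rev_ordK; congr (_ && _).
by have := ltn_ord i; have := ltn_ord k; lia.
Qed.

Lemma nu_min_antitr (d : nat) : initially_convex D -> 0 < d <= n ->
  nu_min D d = nu_min (antitr D) d.
Proof.
move=> convexD /andP[d_gt0 le_dn].
have monoD' := strictly_monotone_antitr convexD.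
have ferD' := ferrers_antitr.
rewrite (nu_min_strictly_monotone ferD' monoD') // -[d.-1]subn0 -nu_antitr //.
apply: nu_min_eq => // j lt_jd; rewrite !nu_antitr // subn0.
by apply: nu_strictly_monotone_min => //; lia.
Qed.

End AntiTranspose.

(** * Reflection of matrices and codes *)

Section AntiTransposeCode.

Local Open Scope ring_scope.

Variables (n : nat) (F : fieldType).

Definition antitr_mx (A : 'M[F]_n) : 'M[F]_n :=
  \matrix_(i, j) A (rev_ord j) (rev_ord i).

Lemma antitr_mx_is_linear : linear antitr_mx.
Proof. by move=> a A B; apply/matrixP => i j; rewrite !mxE. Qed.

HB.instance Definition _ :=
  GRing.isLinear.Build F 'M[F]_n 'M[F]_n _ antitr_mx antitr_mx_is_linear.

Lemma antitr_mxK : involutive antitr_mx.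
Proof. by move=> A; apply/matrixP => i j; rewrite !mxE !rev_ordK. Qed.

(** Reflection is transposition combined with reversals of rows and columns; being an involution, it
    needs only one inequality. *)
Lemma mxrank_antitr (A : 'M[F]_n) : \rank (antitr_mx A) = \rank A.
Proof.
have le_rank B : (\rank (antitr_mx B) <= \rank B)%N.
  have -> : antitr_mx B = rowsub (@rev_ord n) (rowsub (@rev_ord n) B)^T.
    by apply/matrixP => i j; rewrite !mxE.
  rewrite (leq_trans (mxrankS (rowsub_sub _ _))) // mxrank_tr.
  by rewrite mxrankS ?rowsub_sub.
by apply/eqP; rewrite eqn_leq le_rank -{1}[A]antitr_mxK le_rank.
Qed.

Lemma ferrers_code_antitr (D : {set 'I_n * 'I_n}) (k d : nat)
    (C : {vspace 'M[F]_n}) :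
  ferrers_code (antitr D) k d C ->
  ferrers_code D k d (linfun antitr_mx @: C)%VS.
Proof.
move=> [suppC dimC distC].
have memC A : A \in (linfun antitr_mx @: C)%VS -> antitr_mx A \in C.
  by case/memv_imgP=> B CB ->; rewrite lfunE /= antitr_mxK.
split=> [A /memC/suppC suppA i j ijD||].
- rewrite -[A]antitr_mxK mxE suppA // mem_antitr !rev_ordK //.
- rewrite limg_dim_eq //; apply/eqP; rewrite -subv0; apply/subvP => A.
  rewrite memv_cap memv_ker lfunE /= => /andP[_ /eqP A0].
  by rewrite -[A]antitr_mxK A0 linear0 mem0v.
case: distC => [->|[[A [CA A0] rkA] minC]]; [by left | right; split].
  exists (antitr_mx A); last by rewrite mxrank_antitr.
  split; first by rewrite -lfunE memv_img.
  by move/(congr1 antitr_mx); rewrite antitr_mxK linear0.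
move=> B CB B0; rewrite -mxrank_antitr; apply: minC; first exact: memC.
by move/(congr1 antitr_mx); rewrite antitr_mxK linear0.
Qed.

End AntiTransposeCode.

(** * The code spanned by the cell operators of a strictly monotone diagram *)

Section StrictlyMonotoneCode.

Local Open Scope ring_scope.

Lemma mxrank_top_rows (F : fieldType) (n d : nat) (A : 'M[F]_n) :
    (d <= n)%N -> (forall i j : 'I_n, (d <= i)%N -> A i j = 0) ->
  (\rank A <= d)%N.
Proof.
move=> le_dn A0; have -> : A = (pid_mx d : 'M_n) *m A.
  apply/matrixP => i j; rewrite mxE (bigD1 i) //= big1 => [|k ne_ki].
    rewrite mxE eqxx addr0 /=; case: ltnP => [|/A0->]; first by rewrite mul1r.
    by rewrite mulr0.
  by rewrite mxE eq_sym val_eqE (negPf ne_ki) mul0r.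
by rewrite (leq_trans (mxrankM_maxl _ _)) // rank_pid_mx.
Qed.

Variables (F : finFieldType) (L : fieldExtType F) (m : nat) (x : L).
Hypothesis iter_x : iter m tau x = 1.

Local Notation e := (tau_chain m x).
Local Notation B := (tau_basis m x).

Variable D : {set 'I_m.+1 * 'I_m.+1}.
Hypotheses (ferrersD : ferrers D) (monoD : strictly_monotone D).

Definition cell_op (p : 'I_m.+1 * 'I_m.+1) (y : L) : L :=
  e p.1 * iter p.2 tau y.

Definition cell_mx (p : 'I_m.+1 * 'I_m.+1) : 'M[F]_m.+1 :=
  chain_mx m x (cell_op p).

(** For a cell [(s, k)] with [k <= j] the value is [e s * e (j - k)], in the flag of index
    [s + (j - k) + 1]; strict growth from column [k] to column [j] makes this at most the height of
    column [j]. *)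
Lemma cell_op_flag (p : 'I_m.+1 * 'I_m.+1) (j : 'I_m.+1) :
  p \in D -> cell_op p (e j) \in tau_flag m x (col_count D j).
Proof.
case: p => s k; rewrite mem_ferrers // => lt_sc.
have le_jm : (j <= m)%N by rewrite -ltnS.
rewrite /cell_op iter_tau_chain //=.
case: leqP => [le_kj|_] ; last by rewrite mulr0 mem0v.
have le_c := col_count_shift monoD le_kj (leq_ltn_trans (leq0n _) lt_sc).
have c_le := col_count_leq D j.
have le_sm : (s + (j - k) <= m)%N by lia.
by apply: subvP (tau_chainM iter_x le_sm); apply: tau_flag_sub; lia.
Qed.

Lemma cell_mx_supported (p : 'I_m.+1 * 'I_m.+1) :
  p \in D -> supported_on D (cell_mx p).
Proof.
move=> pD i j; rewrite mem_ferrers // -leqNgt => le_ci.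
by rewrite mxE (coord_tau_flag iter_x (cell_op_flag j pD)).
Qed.

Variable d : nat.
Hypotheses (d_gt0 : (0 < d)%N) (le_dn : (d <= m.+1)%N).

Local Notation S := (trimmed D d d.-1).

Lemma mem_cells (p : 'I_m.+1 * 'I_m.+1) :
  (p \in S) = (p \in D) && (p.2 <= m.+1 - d)%N.
Proof.
have D_r : (m.+1 - d.-1 = (m.+1 - d).+1)%N by lia.
by rewrite !inE subnn leq0n andbT D_r ltnS.
Qed.

(** Grouping the cells by column turns the combination into a polynomial in [tau] of degree at most
    [r], to which [chain_mx_rank] applies. *)
Lemma cell_comb_rank (c : 'I_m.+1 * 'I_m.+1 -> F) :
    (exists2 p, p \in S & c p != 0) ->
  (d <= \rank (\sum_(p in S) c p *: cell_mx p)%R)%N.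
Proof.
move=> [p0 p0S cp0]; pose r := (m.+1 - d)%N.
pose a k := \sum_(p in S | p.2 == k :> nat) c p *: e p.1.
pose f y := \sum_(k < r.+1) a k * iter k tau y.
have f_cells y : f y = \sum_(p in S) c p *: cell_op p y.
  pose col (p : 'I_m.+1 * 'I_m.+1) : 'I_r.+1 := inord p.2.
  rewrite (partition_big col xpredT) //=.
  apply: eq_bigr => k _; rewrite mulr_suml.
  apply: eq_big => [p|p /andP[_ /eqP Dk]]; last first.
    by rewrite -scalerAl /cell_op Dk.
  have [/=|//] := boolP (p \in S); rewrite mem_cells => /andP[_ le_pr].
  by rewrite -val_eqE /= inordK.
have fD (j : 'I_m.+1) : f (e j) \in tau_flag m x (col_count D j).
  rewrite f_cells memv_suml // => p; rewrite mem_cells => /andP[pD _].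
  by rewrite memvZ // cell_op_flag.
have -> : \sum_(p in S) c p *: cell_mx p = chain_mx m x f.
  apply/matrixP => i j; rewrite summxE mxE f_cells linear_sum.
  by apply: eq_bigr => p _; rewrite linearZ !mxE.
rewrite -(subKn le_dn); apply: (@chain_mx_rank _ _ _ _ iter_x r a) => [|j].
  exists p0.2; first by move: p0S; rewrite mem_cells => /andP[].
  (* Within one column the cells carry distinct chain elements, so this coordinate of [a p0.2] is
     exactly [c p0]. *)
  apply/eqP => /(congr1 (coord B p0.1)); rewrite linear0 linear_sum.
  rewrite (bigD1 p0) ?p0S ?eqxx //= big1 => [|p /andP[/andP[_ eq2] ne]].
    rewrite addr0 linearZ /= -nth_tau_basis coord_free ?tau_basis_free //.
    by rewrite eqxx mulr1 => c0; rewrite c0 eqxx in cp0.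
  rewrite linearZ /= -nth_tau_basis coord_free ?tau_basis_free //.
  case: (p.1 =P p0.1) => [eq1|_] /=; last by rewrite mulr0.
  case/negP: ne; move: eq1 eq2; case: (p) (p0) => [s k] [s0 k0] /= ->.
  by move=> /eqP/val_inj->.
apply: subvP (fD j); apply: tau_flag_span; apply: col_count_leq.
Qed.

(** The rank bound gives both the independence of the cell matrices, hence the dimension, and the
    lower bound on the distance; a single cell attains it. *)
Lemma nu_trimmed_code :
  exists C : {vspace 'M[F]_m.+1}, ferrers_code D (nu D d d.-1) d C.
Proof.
rewrite nu_card ?prednK //.
have [S0|[p0 p0S]] := set_0Vmem S.
  exists 0%VS; rewrite S0 cards0; split; [| exact: dimv0 | by left].
  by move=> A; rewrite memv0 => /eqP-> i j _; rewrite mxE.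
pose X := [tuple cell_mx (enum_val i) | i < #|S|].
have combE (g : 'I_#|S| -> F) : \sum_(i < #|S|) g i *: X`_i =
    \sum_(p in S) g (enum_rank_in p0S p) *: cell_mx p.
  rewrite [RHS]big_enum_val; apply: eq_bigr => i _.
  by rewrite enum_valK_in -tnth_nth tnth_mktuple.
have comb_rank (g : 'I_#|S| -> F) i : g i != 0 ->
    (d <= \rank (\sum_(i < #|S|) g i *: X`_i)%R)%N.
  move=> gi; rewrite combE.
  apply: (cell_comb_rank (c := fun p => g (enum_rank_in p0S p))).
  by exists (enum_val i); rewrite ?enum_valP ?enum_valK_in.
have freeX : free X.
  apply/freeP=> g sum0 i; apply/eqP/negPn/negP => /comb_rank.
  by rewrite sum0 mxrank0 leqNgt d_gt0.
have cell_in p : p \in S -> cell_mx p \in <<X>>%VS.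
  move=> pS; rewrite memv_span //; apply/tnthP; exists (enum_rank_in p0S p).
  by rewrite tnth_mktuple enum_rankK_in.
exists <<X>>%VS; split.
- move=> A /coord_span->; rewrite combE => i j ijD; rewrite summxE big1 // => p.
  by rewrite mem_cells => /andP[pD _]; rewrite mxE cell_mx_supported ?mulr0.
- by rewrite (eqP freeX) size_tuple.
right; split=> [|A XA A0]; last first.
  have [i gi|g0] := pickP (fun i => coord X i A != 0).
    by rewrite (coord_span XA) (comb_rank _ i).
  case: A0; rewrite (coord_span XA) big1 // => i _.
  by move/negbFE/eqP: (g0 i) => ->; rewrite scale0r.
have lt_r : (m.+1 - d < m.+1)%N by lia.
(* Since [e 0 = 1], this cell gives the pure iterate of [tau] of order n - d; it maps the chain into
   the span of [e 0], ..., [e (d - 1)], so only the first [d] rows can be nonzero. *)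
pose p1 : 'I_m.+1 * 'I_m.+1 := (ord0, Ordinal lt_r).
have p1S : p1 \in S.
  case: ferrersD => rightD upD; move: (p0S); rewrite !mem_cells leqnn andbT.
  case: (p0) => s k /andP[skD le_kr].
  by apply: (upD s) => //; apply: rightD skD _.
have rank_p1 : (d <= \rank (cell_mx p1))%N.
  have := @cell_comb_rank (fun p => (p == p1)%:R).
  rewrite (bigD1 p1) //= eqxx scale1r big1 => [|p /andP[_ /negPf->]].
  by rewrite addr0; apply; exists p1; rewrite ?eqxx ?oner_neq0.
  exact: scale0r.
exists (cell_mx p1).
  split; first exact: cell_in.
  by move=> A0; move: rank_p1; rewrite A0 mxrank0 leqNgt d_gt0.
apply/eqP; rewrite eqn_leq rank_p1 andbT; apply: mxrank_top_rows => //.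
move=> i j le_di.
have le_jm : (j <= m)%N by rewrite -ltnS.
rewrite mxE /cell_op /= tau_chain0 // mul1r iter_tau_chain //.
case: ifP => _; last by rewrite linear0.
apply: (coord_tau_flag iter_x _ le_di); apply: mem_tau_flag.
by have := ltn_ord j; lia.
Qed.

End StrictlyMonotoneCode.

(** * Codes for both classes of diagrams *)

Lemma strictly_monotone_code (d n : nat) (D : {set 'I_n * 'I_n})
    (F : finFieldType) : 0 < d <= n -> ferrers D -> strictly_monotone D ->
  exists C : {vspace 'M[F]_n}, ferrers_code D (nu_min D d) d C.
Proof.
move=> /andP[d_gt0 le_dn] ferrersD monoD.
rewrite nu_min_strictly_monotone //.
case: n D ferrersD monoD le_dn => [|m] D ferrersD monoD le_dn; first by lia.
have [L [x iter_x]] := iter_tau_onto_1 F m.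
exact: (nu_trimmed_code iter_x ferrersD monoD d_gt0 le_dn).
Qed.

Theorem theorem4p10 (d n : nat) (hd : 0 < d) (hdn : d <= n) :
  (forall D : {set 'I_n * 'I_n}, ferrers D -> strictly_monotone D ->
     forall F : finFieldType,
       exists C : {vspace 'M[F]_n}, ferrers_code D (nu_min D d) d C) /\
  (forall D : {set 'I_n * 'I_n}, ferrers D -> initially_convex D ->
     forall F : finFieldType,
       exists C : {vspace 'M[F]_n}, ferrers_code D (nu_min D d) d C).
Proof.
have hdn' : 0 < d <= n by rewrite hd.
split=> D ferrersD shapeD F; first exact: strictly_monotone_code.
have [C codeC] := strictly_monotone_code F hdn' (ferrers_antitr ferrersD)
  (strictly_monotone_antitr ferrersD shapeD).
exists (linfun (@antitr_mx n F) @: C)%VS.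
by apply: ferrers_code_antitr; rewrite nu_min_antitr.
Qed.
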